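(* Let $G$ be a finite abelian group with $n$ elements, and let $S\subseteq G$ be a generating set of $G$ with $0_G\notin S$. Then the cop number of the directed Cayley graph $\mathrm{Cay}(G,S)$ satisfies $$c(\mathrm{Cay}(G,S))\le \sqrt{\frac{2}{(\sqrt{2}-1)\,e}}\;\sqrt{n}+2.$$
   Context: Cops and robbers on a finite strongly connected digraph: first each cop chooses a starting vertex, then the robber chooses a starting vertex. Then cop turns and robber turns alternate, starting with a cop turn. On a cop turn each cop either stays where it is or moves along an arc, in the direction of the arc, to an out-neighbour; on a robber turn the robber does likewise. Several cops may share a vertex, and all players have full information. The cops win if at some point a cop shares a vertex with the robber; the robber wins if this never happens. The cop number $c(\Gamma)$ is the minimum number of cops for which the cops have a winning strategy on $\Gamma$. For a finite abelian group $(G,+)$ and a generating set $S$ with $0_G\notin S$, $\mathrm{Cay}(G,S)$ is the digraph with vertex set $G$ containing the arc from $u$ to $v$ iff $v-u\in S$. Here $e$ is the base of the natural logarithm. *)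

(* Defs.v *)
From mathcomp Require Import all_boot all_fingroup all_algebra.
From mathcomp Require Import boolp.

Set Implicit Arguments.
Unset Strict Implicit.
Unset Printing Implicit Defensive.

Section CopsAndRobbers.

Variables (V : finType) (arc : rel V).

Definition stay_or_move : rel V := [rel u v | (u == v) || arc u v].

(* r 0 is the robber's starting vertex and r t.+1 its vertex after its
   (t+1)-st turn. *)
Definition robber_play (r : nat -> V) : Prop :=
  forall t, stay_or_move (r t) (r t.+1).

(* A strategy for k cops maps the robber's past positions, oldest first, to the
   next positions of the cops (the cops' own past positions are determined by
   these); on the empty history it gives the starting vertices. *)
Definition cop_strategy (k : nat) : Type := seq V -> {ffun 'I_k -> V}.

(* Chronologically: cops_at s r 0, r 0, cops_at s r 1, r 1, cops_at s r 2, ... *)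
Definition cops_at k (s : cop_strategy k) (r : nat -> V) (t : nat) :
  {ffun 'I_k -> V} := s (mkseq r t).

Definition cops_legal k (s : cop_strategy k) (r : nat -> V) : Prop :=
  forall t i, stay_or_move (cops_at s r t i) (cops_at s r t.+1 i).

(* The first disjunct is a meeting after the robber's choice of r t, the second
   one a meeting after the cop turn that follows it. *)
Definition captured k (s : cop_strategy k) (r : nat -> V) : Prop :=
  exists t i, cops_at s r t i = r t \/ cops_at s r t.+1 i = r t.

Definition cops_win (k : nat) : Prop :=
  exists s : cop_strategy k,
    forall r, robber_play r -> cops_legal s r /\ captured s r.

Lemma cops_win_card : exists k, `[< cops_win k >].
Proof.
exists #|V|; apply/asboolP; exists (fun=> [ffun i => enum_val i]) => r _.
split=> [t i|]; first by rewrite /stay_or_move /= eqxx.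
by exists 0, (enum_rank (r 0)); left; rewrite /cops_at ffunE enum_rankK.
Qed.

Definition cop_number : nat := ex_minn cops_win_card.

End CopsAndRobbers.

Definition cayley_arc (G : finZmodType) (S : {set G}) : rel G :=
  [rel u v | (v - u)%R \in S].

(* Main.v *)
Require Import Defs.
From mathcomp Require Import all_boot all_order all_fingroup all_algebra.
From mathcomp Require Import boolp reals sequences exp.
From mathcomp Require Import zify ring lra.

(** Put [T = 0 |: S] and follow, for each cop, the difference [d] between the
    robber and the cop. By copying the robber's move a cop keeps [d] fixed; a cop
    that answers a move [a] with [t] adds [a - t] to [d].

    Induct on the index [n] of a subgroup [H]: more than [C sqrt n + 1] cops can
    bring some difference into [H] (for [H = 0] this is capture). Given
    [x \notin H], the group generated by [H] and [x] has index at most [n / 2], so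
    more than [C sqrt (n / 2) + 1] cops can bring a difference [d] into it. From
    then on that cop adds [x] to [d], modulo [H], whenever the robber plays a move
    of [x + T + H]; hence the robber can play only finitely many of these moves
    before [d] lies in [H]. By averaging over [x \notin H], some [x] handles a
    fraction at least [(tau - 1) / (n - 1)] of the cosets of the moves not yet
    handled, where [tau] is the number of cosets met by [T]. After about
    [C sqrt n - C sqrt (n / 2)] such cops, at most [C sqrt (n / 2) + 1] cosets are
    left, and each gets a cop of its own: for a single coset [a + H] the
    increments [a - t], [t \in T], generate the whole group. *)

Set Implicit Arguments.
Unset Strict Implicit.
Unset Printing Implicit Defensive.
Import Order.TTheory GRing.Theory Num.Theory.
Local Open Scope ring_scope.

(** * The game in terms of the differences between robber and cops *)

Section Game.

Variables (G : finZmodType) (T : {set G}).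

(** A least fixed point: a derivation is a well-founded tree branching over the robber's moves, so
    [Q] is reached in finitely many rounds with no bound to carry along. In each round the robber
    moves first and the cops reply. *)
Inductive forces (I : Type) (Q : (I -> G) -> Prop) (d : I -> G) : Prop :=
| forces_now of Q d
| forces_step (t : G -> I -> G) of
    (forall a i, a \in T -> t a i \in T) &
    (forall a, a \in T -> forces Q (fun i => d i + a - t a i)).

Lemma forces_reply (I : Type) (Q : (I -> G) -> Prop) d :
  (forall a, a \in T -> exists2 t : I -> G,
     forall i, t i \in T & forces Q (fun i => d i + a - t i)) ->
  forces Q d.
Proof.
move=> h.
have /choice[t tP] : forall a, exists t : I -> G, a \in T ->
    (forall i, t i \in T) /\ forces Q (fun i => d i + a - t i).
  move=> a; case: (boolP (a \in T)) => [/h[t ? ?]|_]; first by exists t.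
  by exists (fun=> 0).
by apply: (@forces_step _ _ _ t) => [a i|a] /tP[].
Qed.

Lemma forces_trans (I : Type) (Q Q' : (I -> G) -> Prop) d :
  forces Q d -> (forall d', Q d' -> forces Q' d') -> forces Q' d.
Proof.
by elim=> {}d => [Qd|t tT _ IH] QQ'; [exact: QQ' | apply: (forces_step tT); auto].
Qed.

End Game.

(** * From forced differences to strategies on histories *)

Lemma mkseqS_shift (V : Type) (r : nat -> V) t :
  mkseq r t.+1 = r 0%N :: mkseq (fun n => r n.+1) t.
Proof. by rewrite /mkseq /= -[1%N]addn0 iotaDl -map_comp. Qed.

Section Strategy.

Variables (G : finZmodType) (S : {set G}).

Lemma stay_or_moveE u v :
  stay_or_move (cayley_arc S) u v = (v - u \in 0 |: S).
Proof. by rewrite /stay_or_move /= in_setU1 subr_eq0 eq_sym. Qed.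

Lemma forces_strategy k (d : 'I_k -> G) :
  forces (0 |: S) (fun d => exists i, d i = 0) d ->
  forall (c : {ffun 'I_k -> G}) r0, (forall i, d i = r0 - c i) ->
  exists s : cop_strategy G k, s [:: r0] = c /\
    forall r, r 0%N = r0 -> robber_play (cayley_arc S) r ->
      (forall t i, stay_or_move (cayley_arc S) (s (mkseq r t.+1) i)
                                               (s (mkseq r t.+2) i)) /\
      exists t i, s (mkseq r t.+1) i = r t.
Proof.
elim=> {d} [d [i di0]|d t tT _ IH] c r0 dE.
  exists (fun=> c); split=> // r r00 _; split=> [u j|].
    by rewrite stay_or_moveE subrr setU11.
  by exists 0%N, i; apply/eqP; rewrite r00 eq_sym -subr_eq0 -dE di0.
have /choice[s sP] : forall a, exists s : cop_strategy G k, a \in 0 |: S ->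
    s [:: r0 + a] = [ffun i => c i + t a i] /\
    forall r, r 0%N = r0 + a -> robber_play (cayley_arc S) r ->
      (forall u i, stay_or_move (cayley_arc S) (s (mkseq r u.+1) i)
                                               (s (mkseq r u.+2) i)) /\
      exists u i, s (mkseq r u.+1) i = r u.
  move=> a; case: (boolP (a \in 0 |: S)) => aT; last by exists (fun=> c).
  have [i|s [s0 sP]] := IH a aT [ffun i => c i + t a i] (r0 + a).
    by rewrite ffunE dE opprD !addrA [r0 - _ + _]addrAC.
  by exists s.
(* After the robber's first move the subderivation for [r1 - r0] takes over, reading the history
   without its head; [c] answers the history of length one. *)
exists (fun h => if h is _ :: r1 :: h' then s (r1 - r0) (r1 :: h') else c).
split=> // r r00 rP; set r' := fun n => r n.+1.
have aT : r 1%N - r0 \in 0 |: S by rewrite -r00 -stay_or_moveE; exact: rP.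
have [s1 /(_ r')[]] := sP _ aT; first by rewrite /r' addrC subrK.
  by move=> u; exact: rP.
move=> legal [u [i capt]]; split=> [[|v] j|].
- rewrite [r0 + _]addrC subrK in s1.
  by rewrite /mkseq /= s1 stay_or_moveE ffunE addrAC subrr add0r tT.
- rewrite (mkseqS_shift r v.+1) (mkseqS_shift r v.+2) -/r'.
  have := legal v j.
  by rewrite !(mkseqS_shift r').
- exists u.+1, i; rewrite mkseqS_shift -/r' -[RHS]capt.
  by rewrite !(mkseqS_shift r').
Qed.

(** The cops start at 0 and idle on their first turn; from then on the robber moves first in each
    round, as in [forces]. *)
Lemma forces_cops_win k :
  (forall d : 'I_k -> G, forces (0 |: S) (fun d => exists i, d i = 0) d) ->
  cops_win (cayley_arc S) k.
Proof.
move=> h; pose c : {ffun 'I_k -> G} := [ffun=> 0].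
have /choice[s sP] := fun r0 =>
  @forces_strategy k _ (h (fun i => r0 - c i)) c r0 (fun=> erefl).
exists (fun hist => if hist is r0 :: _ then s r0 hist else c) => r rP.
have [s0 /(_ r erefl rP)[legal [t [i capt]]]] := sP (r 0%N).
split=> [[|u] j|].
- by rewrite /cops_at /= s0 stay_or_moveE subrr setU11.
- by have := legal u j; rewrite /cops_at !(mkseqS_shift r).
- by exists t, i; right; rewrite -[RHS]capt /cops_at (mkseqS_shift r).
Qed.

End Strategy.

(** * Cops guarding sets of robber moves *)

Section Guards.

Variables (G : finZmodType) (T : {set G}).

(* [m] increments taken from [D] bring the difference [d] into [H]. *)
Fixpoint within (H D : {set G}) (m : nat) (d : G) : Prop :=
  if m is m'.+1 then exists2 x, x \in D & within H D m' (d + x) else d \in H.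

Definition enclosed (H D : {set G}) (d : G) : Prop := exists m, within H D m d.

(* The robber moves to which a cop can reply by adding to its difference,
   modulo [H], any prescribed element of [D]. *)
Definition guarded (H D : {set G}) (b : G) : Prop :=
  forall x, x \in D -> exists2 t, t \in T & b - t - x \in H.

Lemma group_addP (H : {group G}) x y : x \in H -> y \in H -> x + y \in H.
Proof. exact: groupM. Qed.

Lemma group_oppP (H : {group G}) x : x \in H -> - x \in H.
Proof. by move=> xH; exact: groupVr. Qed.

Lemma within_addr (H : {group G}) D m d h :
  h \in H -> within H D m d -> within H D m (d + h).
Proof.
move=> hH; elim: m d => [|m IH] d /=; first by move=> dH; exact: group_addP.
by case=> x xD /IH; rewrite addrAC; exists x.
Qed.

Lemma within_congr (H : {group G}) D m d d' :
  d' - d \in H -> within H D m d -> within H D m d'.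
Proof. by move=> hH /(within_addr hH); rewrite addrC subrK. Qed.

(** The translations preserving [enclosed] form a group. It contains [H], and also [- x] for
    [x \in D], since the increment [x] leads from [e - x] back to [e]. *)
Lemma enclosed_gen (H : {group G}) D d : d \in <<H :|: D>>%g -> enclosed H D d.
Proof.
pose stab := [set x | `[< forall d, enclosed H D d -> enclosed H D (d + x) >]].
have stabP x : reflect (forall d, enclosed H D d -> enclosed H D (d + x))
    (x \in stab) by rewrite inE; exact: asboolP.
have grp : group_set stab.
  apply/group_setP; split; first by apply/stabP => e; rewrite FinRing.zmod1gE addr0.
  move=> x y /stabP hx /stabP hy; apply/stabP => e.
  by rewrite FinRing.zmodMgE addrA => /hx /hy.
pose K := Group grp.
suff sK : (<<H :|: D>> \subset K)%g.
  move=> /(subsetP sK)/stabP/(_ 0); rewrite add0r; apply.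
  by exists 0%N; exact: group1.
rewrite gen_subG subUset; apply/andP; split; apply/subsetP => x xHD.
  by apply/stabP => e [m em]; exists m; exact: within_addr.
rewrite -groupV; apply/stabP => e [m em]; exists m.+1, x => //.
by rewrite FinRing.zmodVgE subrK.
Qed.

Variable I : finType.

(** The second clause keeps guards outside [J] enclosed while the cops of [J] are repositioned. *)
Definition captures (J : {set I}) (H : {set G}) (d d' : I -> G) : Prop :=
  (exists2 i, i \in J & d' i \in H) /\ (forall i, i \notin J -> d' i = d i).

(** The potential is the total number of increments still needed. On each robber move one guard of
    that move makes its next increment and all other cops copy the robber, so the potential drops by
    one. *)
Lemma forces_guarded (H : {group G}) (J : {set I}) (D : I -> {set G}) d :
  (forall a, a \in T -> exists2 i, i \in J & guarded H (D i) a) ->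
  (forall i, i \in J -> enclosed H (D i) (d i)) ->
  forces T (captures J H d) d.
Proof.
move=> cover encl.
have /choice[m mP] : forall i, exists m, i \in J -> within H (D i) m (d i).
  by move=> i; case: (boolP (i \in J)) => [/encl[m ?]|_]; [exists m | exists 0%N].
suff main N e : (\sum_(i in J) m i < N)%N ->
    (forall i, i \in J -> within H (D i) (m i) (e i)) ->
    (forall i, i \notin J -> e i = d i) -> forces T (captures J H d) e.
  by apply: (main _ d (ltnSn _)).
elim: N => // N IH in m e {mP} *; rewrite ltnS => leN mP eE.
case: (pselect (exists2 i, i \in J & m i = 0%N)) => [[i iJ mi0]|m_gt0].
  apply: forces_now; split=> //; exists i => //.
  by have := mP i iJ; rewrite mi0.
apply: forces_reply => a aT; have [i iJ ga] := cover a aT.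
case Dm: (m i) (mP i iJ) => [|m']; first by case: m_gt0; exists i.
move=> [x xD wi]; have [t tT tH] := ga x xD.
exists (fun j => if j == i then t else a) => [j|]; first by case: ifP.
apply: (IH (fun j => if j == i then m' else m j)).
- apply: leq_trans leN; rewrite (bigD1 i) //= eqxx (bigD1 i iJ) /= Dm.
  rewrite addSn ltnS leq_add2l; apply: leq_sum => j /andP[_ /negPf->] //.
- move=> j jJ; case: eqVneq => [->|ji]; last by rewrite addrK; exact: mP.
  apply: within_congr wi; suff -> : e i + a - t - (e i + x) = a - t - x by [].
  by rewrite -[e i + a - t]addrA [e i + (a - t)]addrC addrKA.
- move=> j jJ; case: eqVneq => [ji|_]; last by rewrite addrK; exact: eE.
  by move: jJ; rewrite ji iJ.
Qed.

End Guards.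

(** * Coset representatives and averaging *)

Section Counting.

Variable G : finZmodType.

Lemma coset_representatives (H : {group G}) (A : {set G}) :
  (forall a h, a \in A -> h \in H -> a + h \in A) ->
  exists2 X : {set G}, (#|X| * #|H| <= #|A|)%N &
    forall a, a \in A -> exists2 x, x \in X & a - x \in H.
Proof.
have [N] := ubnP #|A|; elim: N => // N IH in A *; rewrite ltnS => leN satA.
have [->|[a aA]] := set_0Vmem A.
  by exists set0 => [|a]; rewrite ?cards0 // inE.
pose C := (H :* a)%g.
have CE b : (b \in C) = (b - a \in H) by rewrite mem_rcoset.
have sCA : C \subset A.
  by apply/subsetP => b; rewrite CE => /(satA _ _ aA); rewrite addrC subrK.
have cardC : (#|A :\: C| + #|H| = #|A|)%N.
  by rewrite -(card_rcoset H a) -(cardsID C A) (setIidPr sCA) addnC.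
have [||X leX XP] := IH (A :\: C).
- by apply: leq_trans leN; rewrite -cardC -addn1 leq_add2l cardG_gt0.
- move=> b h; rewrite !inE !CE => /andP[bC bA] hH; rewrite satA // andbT.
  by apply: contra bC => /group_addP/(_ (group_oppP hH)); rewrite addrAC addrK.
exists (a |: X) => [|b bA].
  rewrite -cardC (leq_trans _ (leq_add leX (leqnn _))) // -mulSnr leq_mul2r.
  by rewrite cardsU1 -add1n leq_add2r leq_b1 orbT.
have [bC|bC] := boolP (b \in C).
  by exists a; rewrite ?setU11 // -CE.
have [|x xX bx] := XP b; first by rewrite inE bC.
by exists x => //; rewrite setU1r.
Qed.

(** For each [a \in A] there are [#|~: B|] values of [y] with [a - y] outside [B]; the minimiser [x]
    does no worse than the average over [~: H]. With [B = T * H], the set on the left is what a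
    guard with increment [x] leaves of [A]. *)
Lemma popular_difference (H A B : {set G}) x0 : x0 \notin H ->
  exists2 x, x \notin H &
    (#|[set a in A | (a - x)%R \notin B]| * #|~: H| <= #|A| * #|~: B|)%N.
Proof.
move=> x0H; pose f x := #|[set a in A | a - x \notin B]|.
case: (@arg_minnP _ x0 (fun x => x \notin H) f x0H) => x xH xmin; exists x => //.
rewrite mulnC -sum_nat_const.
apply: (@leq_trans (\sum_(y in ~: H) f y)).
  by apply: leq_sum => y; rewrite inE => /xmin.
apply: (@leq_trans (\sum_y f y)).
  by rewrite [leqRHS](bigID (fun y => y \in ~: H)) leq_addr.
have fE y : f y = (\sum_(a in A) ((a - y)%R \notin B))%N.
  by rewrite /f -sum1dep_card big_mkcondr.
rewrite (eq_bigr _ (fun y _ => fE y)) exchange_big -sum_nat_const /=.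
apply: leq_sum => a _; rewrite -big_mkcond sum1dep_card.
rewrite -(card_imset (~: B) (can_inj (subKr a))) subset_leq_card //.
apply/subsetP => y; rewrite inE => yB; apply/imsetP; exists (a - y).
  by rewrite inE.
by rewrite subKr.
Qed.

End Counting.

Lemma card_le_onto (U V : finType) (J : {set U}) (X : {set V}) (v0 : V) :
  (#|X| <= #|J|)%N ->
  exists f : U -> V, forall x, x \in X -> exists2 i, i \in J & f i = x.
Proof.
move=> leXJ; exists (fun i => nth v0 (enum X) (index i (enum J))) => x xX.
have lt_x : (index x (enum X) < size (enum J))%N.
  by rewrite -cardE (leq_trans _ leXJ) // cardE index_mem mem_enum.
have [i0 _] : exists i0, i0 \in J.
  by apply/set0Pn; rewrite -card_gt0 cardE (leq_ltn_trans _ lt_x).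
exists (nth i0 (enum J) (index x (enum X))).
  by rewrite -mem_enum mem_nth.
by rewrite index_uniq ?enum_uniq // nth_index // mem_enum.
Qed.

(** * The estimate that determines the constant *)

Section Numeric.

Variable R : realType.

Definition meyniel_const : R := Num.sqrt (2 / ((Num.sqrt 2 - 1) * expR 1)).

Lemma meyniel_const_ge0 : 0 <= meyniel_const.
Proof. exact: sqrtr_ge0. Qed.

(** This is [1 + (u - 1) <= expR (u - 1)] multiplied by [expR (- u)]. *)
Lemma mulr_expRN_le (u : R) : u * expR (- u) <= expR (- 1).
Proof.
have := expR_ge1Dx (u - 1); rewrite addrC subrK expRD => h.
rewrite -(ler_pM2r (expR_gt0 u)) -mulrA [expR (- u) * _]mulrC expRxMexpNx_1.
by rewrite mulr1 mulrC.
Qed.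

(* The value of [meyniel_const] comes from here: it makes [n / (k e)], which
   bounds the left-hand side up to 1, equal to [C sqrt (n / 2)] for
   [k = C sqrt n - C sqrt (n / 2)]. *)
Lemma greedy_bound (n tau : R) (k : nat) : 1 < n -> 1 <= tau -> tau <= n ->
  meyniel_const * Num.sqrt n - meyniel_const * Num.sqrt (n / 2) < k%:R ->
  tau * ((n - tau) / (n - 1)) ^+ k <= meyniel_const * Num.sqrt (n / 2) + 1.
Proof.
move=> n1 tau1 taun ltk.
set C := meyniel_const in ltk *; set s : R := Num.sqrt 2.
have s2 : s * s = 2 by rewrite -expr2 sqr_sqrtr.
have s0 : 0 < s by rewrite sqrtr_gt0.
have s1 : 1 < s by rewrite ltNge; apply/negP => s1; nra.
have e0 : 0 < expR 1 :> R := expR_gt0 1.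
have C2 : C * C * ((s - 1) * expR 1) = 2.
  rewrite -expr2 sqr_sqrtr ?mulfVK //; first by rewrite mulf_neq0 ?gt_eqF ?subr_gt0.
  by apply: ltW; rewrite divr_gt0 // mulr_gt0 // subr_gt0.
have sqrt_half : Num.sqrt (n / 2) * s = Num.sqrt n.
  have n20 : 0 <= n / 2 by rewrite divr_ge0 //; lra.
  by rewrite -sqrtrM // divfK // pnatr_eq0.
have nn : Num.sqrt n * Num.sqrt n = n by rewrite -expr2 sqr_sqrtr //; lra.
have h0 : 0 < Num.sqrt (n / 2) by rewrite sqrtr_gt0 divr_gt0 //; lra.
set h := Num.sqrt (n / 2) in ltk sqrt_half h0 *.
have C0 : 0 < C.
  rewrite lt_neqAle meyniel_const_ge0 andbT eq_sym; apply/eqP => C0.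
  by move: C2; rewrite C0 !mul0r => /eqP; rewrite eq_sym pnatr_eq0.
have k0 : 0 < k%:R :> R.
  apply: lt_trans ltk; rewrite -mulrBr mulr_gt0 // -sqrt_half subr_gt0.
  by rewrite ltr_pMr.
(* Split [tau = sg + 1]: [mulr_expRN_le] with [u = k sg / N] bounds [sg * E], and [E <= 1] accounts
   for the summand 1. *)
set N := n - 1; set sg := tau - 1; set E := expR (- (k%:R * (sg / N))).
have N0 : 0 < N by rewrite subr_gt0.
have sg0 : 0 <= sg by rewrite subr_ge0.
have leE : ((n - tau) / N) ^+ k <= E.
  have -> : (n - tau) / N = 1 - sg / N.
    by rewrite /sg /N; field; rewrite gt_eqF.
  rewrite /E -[- (k%:R * _)]mulrN expRM_natl lerXn2r ?nnegrE ?expR_ge0 ?expR_ge1Dx //.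
  by rewrite subr_ge0 ler_pdivrMr // mul1r /sg /N; lra.
have E1 : E <= 1.
  by rewrite expR_le1 oppr_le0 mulr_ge0 ?divr_ge0 // ltW.
have sgE : sg * E <= N / k%:R * expR (- 1).
  have -> : sg * E = N / k%:R * (k%:R * (sg / N) * E).
    by field; rewrite !gt_eqF.
  by rewrite ler_pM2l ?divr_gt0 // mulr_expRN_le.
have Nk : N / k%:R * expR (- 1) <= C * h.
  rewrite expRN mulrAC ler_pdivrMr // ler_pdivrMr //.
  apply: (@le_trans _ _ n); first by rewrite /N; lra.
  have -> : n = C * h * (C * (h * s) - C * h) * expR 1.
    transitivity (C * C * ((s - 1) * expR 1) * (h * h)); last by ring.
    by rewrite C2 -[LHS]nn -sqrt_half mulrACA s2 mulrC.
  rewrite -sqrt_half in ltk.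
  by rewrite ler_pM2r // ler_pM2l ?mulr_gt0 // ltW.
apply: (@le_trans _ _ (tau * E)).
  by rewrite ler_wpM2l // (le_trans ler01).
have -> : tau * E = sg * E + E by rewrite /sg; ring.
by rewrite lerD // (le_trans sgE).
Qed.

End Numeric.

(** * Greedy placement of guards and induction on the index *)

Section Capture.

Variables (R : realType) (G : finZmodType) (T : {set G}) (I : finType).
Hypotheses (T0 : 0 \in T) (genT : <<T>>%g = [set: G]).

Lemma guarded1 (H : {set G}) x a : a - x \in (T * H)%g -> guarded T H [set x] a.
Proof.
case/mulsgP => t h tT hH axE y /set1P->; exists t => //.
by rewrite addrAC axE FinRing.zmodMgE addrC addrA addNr add0r.
Qed.

Lemma guarded_coset (H : {set G}) x a :
  a - x \in H -> guarded T H [set x - t | t in T] a.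
Proof.
move=> axH y /imsetP[t tT ->]; exists t => //.
by rewrite opprB addrA subrK.
Qed.

(** As [0 \in T], the increments include [x] itself, so they generate every [t = x - (x - t)]. *)
Lemma enclosed_coset (H : {group G}) x d :
  enclosed H [set x - t | t in T] d.
Proof.
apply: enclosed_gen; set D := [set _ | _ in _].
have sD : D \subset <<H :|: D>>%g by rewrite sub_gen ?subsetUr.
have DP t : t \in T -> x - t \in <<H :|: D>>%g.
  by move=> tT; apply: (subsetP sD); apply: imset_f.
suff : ([set: G] \subset <<H :|: D>>)%g by move/subsetP; apply.
rewrite -genT gen_subG; apply/subsetP => t tT.
rewrite -[t](subKr x); apply: group_addP; last exact: group_oppP (DP t tT).
by rewrite -[x]subr0 DP.
Qed.

(** Invariant: the cops of [J :\: J0] guard all moves outside [A], those of [J0] are free, and [k]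
    guards with a single increment are still to be placed. Each placement needs [q] free cops but
    uses up only one, so the last may leave [q - 1]; hence the successor in the bound on [#|J0|]. *)
Lemma forces_greedy (H : {group G}) (J : {set I}) (y : R) (q : nat) d0 x0 :
  x0 \notin H -> y + 1 < q%:R ->
  (forall x, x \notin H -> forall (J0 : {set I}) d, (q <= #|J0|)%N ->
     forces T (captures J0 <<H :|: [set x]>>%g d) d) ->
  forall k (A : {set G}) (J0 : {set I}) (D : I -> {set G}) d,
    J0 \subset J -> (forall i, i \notin J -> d i = d0 i) ->
    (forall i, i \in J :\: J0 -> enclosed H (D i) (d i)) ->
    (forall a, a \in T -> a \notin A ->
       exists2 i, i \in J :\: J0 & guarded T H (D i) a) ->
    (forall a h, a \in A -> h \in H -> a + h \in A) ->
    (q + k <= #|J0|.+1)%N ->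
    #|A|%:R * (#|~: (T * H)%g|%:R / #|~: H|%:R) ^+ k <= (y + 1) * #|H|%:R ->
  forces T (captures J H d0) d.
Proof.
move=> x0H yq IH; set rho := _ / _.
have cH0 : 0 < #|~: H|%:R :> R.
  by rewrite ltr0n card_gt0; apply/set0Pn; exists x0; rewrite inE.
have rho0 : 0 <= rho by rewrite divr_ge0.
elim=> [|k IHk] A J0 D d sJ0 dE encl cover satA cardJ0 cardA.
  (* At most [y + 1], hence fewer than [q], cosets remain in [A]: each gets a free cop. *)
  have [X leX XP] := coset_representatives satA.
  have ltXq : (#|X| < q)%N.
    rewrite -(ltr_nat R); apply: le_lt_trans yq.
    rewrite -(@ler_pM2r _ #|H|%:R) ?ltr0n ?cardG_gt0 //.
    by move: cardA; rewrite expr0 mulr1; apply: le_trans; rewrite -natrM ler_nat.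
  have [f fP] : exists f : I -> G,
      forall x, x \in X -> exists2 i, i \in J0 & f i = x.
    apply: (@card_le_onto _ _ _ _ 0).
    by rewrite -ltnS (leq_trans ltXq) // -[q]addn0.
  pose D' i := if i \in J0 then [set f i - t | t in T] else D i.
  apply: (@forces_trans _ _ _ (captures J H d)).
    apply: (@forces_guarded _ _ _ _ _ D') => [a aT|i iJ].
      have [aA|aA] := boolP (a \in A).
        have [x xX axH] := XP a aA; have [i iJ0 fi] := fP x xX.
        exists i; first exact: (subsetP sJ0).
        by rewrite /D' iJ0 fi; exact: guarded_coset.
      have [i] := cover a aT aA; rewrite inE => /andP[iJ0 iJ] ga.
      by exists i => //; rewrite /D' (negPf iJ0).
    rewrite /D'; case: ifPn => iJ0; first exact: enclosed_coset.
    by apply: encl; rewrite inE iJ0.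
  move=> d' [hit eqd]; apply: forces_now; split=> // i iJ.
  by rewrite eqd // dE.
have [x xH xP] := popular_difference A (T * H)%g x0H.
set A' := [set a in A | _] in xP.
(* A free cop [i] is brought into the group generated by [H] and [x]; it becomes the guard with
   increment [x]. *)
apply: forces_trans (IH x xH J0 d _) _; first by lia.
move=> d' [[i iJ0 di] eqd].
pose D' j := if j == i then [set x] else D j.
have JE j : (j \in J :\: (J0 :\ i)) = (j == i) || (j \in J :\: J0).
  rewrite !inE; case: eqVneq => [->|] //=.
  by rewrite (subsetP sJ0).
apply: (IHk A' (J0 :\ i) D' d').
- exact: subset_trans (subsetDl _ _) sJ0.
- move=> j jJ; rewrite eqd ?dE //.
  by apply: contra jJ; exact: (subsetP sJ0).
- move=> j; rewrite JE /D'; case: eqVneq => [->|_] /= jP.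
    exact: enclosed_gen.
  by rewrite eqd; [exact: encl | move: jP; rewrite inE => /andP[]].
- move=> a aT aA'; have [aA|aA] := boolP (a \in A).
    exists i; first by rewrite JE eqxx.
    rewrite /D' eqxx; apply: guarded1.
    by move: aA'; rewrite inE aA /= negbK.
  have [j jJ ga] := cover a aT aA; exists j; first by rewrite JE jJ orbT.
  rewrite /D'; case: eqVneq => // ji.
  by move: jJ; rewrite ji inE iJ0.
- move=> a h; rewrite !inE => /andP[aA ax] hH; rewrite satA //=.
  apply: contra ax => /mulsgP[t h' tT h'H E].
  apply/mulsgP; exists t (h' - h) => //.
    by apply: group_addP => //; exact: group_oppP.
  rewrite FinRing.zmodMgE addrA -[t + h'](FinRing.zmodMgE t h') -E.
  by rewrite [a + h - x]addrAC addrK.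
- by move: cardJ0; rewrite (cardsD1 i J0) iJ0; lia.
- apply: le_trans cardA; rewrite exprS mulrA ler_wpM2r ?exprn_ge0 //.
  by rewrite mulrA ler_pdivlMr // -!natrM ler_nat.
Qed.

Lemma forces_captures (H : {group G}) (J : {set I}) d :
  meyniel_const R * Num.sqrt (#|G|%:R / #|H|%:R) + 1 < #|J|%:R ->
  forces T (captures J H d) d.
Proof.
have [N] := ubnP #|~: H|; elim: N => // N IHN in H J d *.
rewrite ltnS => leN ltJ.
have [Hfull|[x0 x0H]] := set_0Vmem (~: H).
  have [i iJ] : exists i, i \in J.
    apply/set0Pn; rewrite -card_gt0 -(ltr_nat R); apply: le_lt_trans ltJ.
    by rewrite addr_ge0 ?mulr_ge0 ?meyniel_const_ge0 ?sqrtr_ge0.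
  apply: forces_now; split=> //; exists i => //.
  by apply/negPn; rewrite -in_setC Hfull inE.
rewrite inE in x0H.
have H0 : 0 < #|H|%:R :> R by rewrite ltr0n cardG_gt0.
have cardHC : #|~: H|%:R = #|G|%:R - #|H|%:R :> R.
  by rewrite -(cardsC H) natrD addrAC subrr add0r.
have n1 : 1 < #|G|%:R / #|H|%:R :> R.
  rewrite ltr_pdivlMr // mul1r -subr_gt0 -cardHC ltr0n card_gt0.
  by apply/set0Pn; exists x0; rewrite inE.
set n : R := #|G|%:R / #|H|%:R in ltJ n1 *.
pose y := meyniel_const R * Num.sqrt (n / 2).
have y0 : 0 <= y by rewrite mulr_ge0 ?meyniel_const_ge0 ?sqrtr_ge0.
(* The least integer above [y + 1]: enough cops for any subgroup of at most half the index. *)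
pose q := (Num.trunc y).+2.
have /andP[qy yq] : (Num.trunc y)%:R <= y < (Num.trunc y).+1%:R by exact: truncn_itv.
have lty : y <= meyniel_const R * Num.sqrt n.
  rewrite ler_wpM2l ?meyniel_const_ge0 // ler_wsqrtr //; lra.
have qJ : (q <= #|J|.+1)%N.
  rewrite -(ler_nat R) /q -!natr1; lra.
(* All cops start free and all of [T * H] unguarded. This [k] is the largest that the budget allows,
   and [q <= y + 2] makes it exceed the threshold of [greedy_bound]. *)
apply: (@forces_greedy H J y q d x0 x0H _ _ (#|J|.+1 - q) (T * H)%g J
          (fun=> set0)) => //.
- by rewrite /q -natr1 ltrD2r.
- move=> x xH J0 e leJ0; apply: IHN.
    apply: leq_trans leN; apply: proper_card; rewrite properC.
    apply/properP; split; first by rewrite sub_gen ?subsetUl.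
    by exists x => //; rewrite mem_gen // !inE eqxx orbT.
  have le2 : 2 * #|H|%:R <= #|<<H :|: [set x]>>%g|%:R :> R.
    have sH : H \subset <<H :|: [set x]>>%g by rewrite sub_gen ?subsetUl.
    rewrite -natrM ler_nat -(Lagrange sH) mulnC leq_mul2l indexg_gt1.
    apply/orP; right; apply: contra xH => /subsetP; apply.
    by rewrite mem_gen // !inE eqxx orbT.
  apply: (@le_lt_trans _ _ (y + 1)); last first.
    apply: lt_le_trans (_ : q%:R <= _); last by rewrite ler_nat.
    by rewrite /q -natr1 ltrD2r.
  rewrite lerD2r ler_wpM2l ?meyniel_const_ge0 // ler_wsqrtr //.
  rewrite /n -mulrA -invfM ler_wpM2l // lef_pV2 ?posrE ?mulr_gt0 //.
    by rewrite mulrC.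
  by apply: lt_le_trans le2; rewrite mulr_gt0.
- by move=> i; rewrite setDv inE.
- move=> a aT /negP[]; apply/mulsgP; exists a 0 => //; first exact: group1.
  by rewrite FinRing.zmodMgE addr0.
- move=> a h /mulsgP[t h' tT h'H ->] hH.
  apply/mulsgP; exists t (h' + h) => //; first exact: group_addP.
  by rewrite !FinRing.zmodMgE addrA.
- by rewrite addnC subnK.
- pose tau : R := #|(T * H)%g|%:R / #|H|%:R.
  have sH : H \subset (T * H)%g by exact: mulg_subr.
  have cardTC : #|~: (T * H)%g|%:R = #|G|%:R - #|(T * H)%g|%:R :> R.
    by rewrite -(cardsC (T * H)%g) natrD addrAC subrr add0r.
  have -> : #|~: (T * H)%g|%:R / #|~: H|%:R = (n - tau) / (n - 1).
    rewrite cardTC cardHC /n /tau; field.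
    by rewrite !gt_eqF // mulN1r subr_gt0 -[#|H|%:R]mul1r -ltr_pdivlMr.
  rewrite -ler_pdivrMr // mulrAC; apply: greedy_bound => //.
  + by rewrite /tau ler_pdivlMr // mul1r ler_nat subset_leq_card.
  + by rewrite ler_pM2r ?invr_gt0 // ler_nat max_card.
  + rewrite natrB // -/y -!natr1; lra.
Qed.

End Capture.

Theorem theorem4p8 (R : realType) (G : finZmodType) (S : {set G})
    (genS : <<S>>%g = [set: G]) (S0 : 0 \notin S) :
  (cop_number (cayley_arc S))%:R <=
    Num.sqrt (2 / ((Num.sqrt 2 - 1) * expR 1)) * Num.sqrt (#|G|%:R) + 2 :> R.
Proof.
rewrite -/(meyniel_const R); set x := _ * Num.sqrt _.
have x0 : 0 <= x by rewrite mulr_ge0 ?meyniel_const_ge0 ?sqrtr_ge0.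
have /andP[xlo xhi] := truncn_itv x0.
(* Above [x + 1], as [forces_captures] requires for the trivial subgroup, yet at most [x + 2]. *)
pose K := (Num.trunc x).+2.
suff winK : cops_win (cayley_arc S) K.
  rewrite /cop_number; case: ex_minnP => m _ /(_ K).
  move=> /(_ (introT (asboolP _) winK)); rewrite -(ler_nat R) => leK.
  by rewrite (le_trans leK) // /K -!natr1; lra.
apply: forces_cops_win => d.
have T0 : 0 \in 0 |: S by rewrite setU11.
have genT : <<0 |: S>>%g = [set: G].
  by apply/eqP; rewrite eqEsubset subsetT -genS gen_subG sub_gen ?subsetUr.
have := @forces_captures R G (0 |: S) 'I_K T0 genT 1%G setT d.
rewrite cards1 divr1 -/x cardsT card_ord => /(_ _)/forces_trans; apply.
  by rewrite /K -natr1 ltrD2r.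
move=> d' [[i _ /set1P di] _]; apply: forces_now; by exists i.
Qed.
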